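(* Let $\rho>0$, $m,m'\in(-\sqrt\rho,\sqrt\rho)$ and $N\in\mathbb{N}$. Then \[ w_2(\mu_{\mathrm{MC}}^{m,\rho;N},\mu_{\mathrm{MC}}^{m',\rho;N};N)\le\left(1+\frac{2}{\sqrt{1-m^2/\rho}}\right)|m-m'|. \]
   Context: Identify the lattice $\Lambda$ ($N=|\Lambda|$) with $[N]$ and field configurations with $\phi\in\mathbb{R}^N$. For $\rho>0$ and $m\in(-\sqrt\rho,\sqrt\rho)$, the auxiliary microcanonical ensemble $\mu_{\mathrm{MC}}^{m,\rho;N}$ is the normalized uniform (surface) probability measure on the $(N-2)$-sphere $\{\phi\in\mathbb{R}^N:\sum_x\phi_x=mN,\ \sum_x\phi_x^2=\rho N\}$; equivalently, with $U$ an orthogonal matrix with $(U\phi)_1=N^{-1/2}\sum_x\phi_x$, $\langle f\rangle_{\mathrm{MC}}^{m,\rho;N}=\frac1{|\mathbb{S}^{N-2}|}\int_{\mathbb{S}^{N-2}}d\Omega\,f(U^{-1}(m\sqrt N,\sqrt{N(\rho-m^2)}\Omega))$. $w_2(\mu_1,\mu_2;N)=\left(\inf_\gamma\int\gamma(dx,dy)\frac1N\sum_{i=1}^N|x_i-y_i|^2\right)^{1/2}$ over couplings $\gamma$ of $\mu_1,\mu_2$. *)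

(* Defs.v *)
From HB Require Import structures.
From mathcomp Require Import all_boot all_order all_algebra.
From mathcomp Require Import all_classical all_reals all_analysis.
Set Implicit Arguments. Unset Strict Implicit. Unset Printing Implicit Defensive.
Import Order.TTheory GRing.Theory Num.Theory.
Local Open Scope classical_set_scope.
Local Open Scope ring_scope.

Section Defs.
Variable R : realType.

Definition box d (a b : 'rV[R]_d) : set 'rV[R]_d :=
  [set x | forall i, a 0 i <= x 0 i <= b 0 i].

Definition box_vol d (a b : 'rV[R]_d) : R :=
  \prod_(i < d) Num.max (b 0 i - a 0 i) 0.

Definition lebesgue_outer d (A : set 'rV[R]_d) : \bar R :=
  ereal_inf [set s | exists a b : nat -> 'rV[R]_d,
     A `<=` \bigcup_k box (a k) (b k) /\
     s = (\sum_(0 <= k <oo) (box_vol (a k) (b k))%:E)%E].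

Definition unit_sphere d : set 'rV[R]_d :=
  [set w | \sum_(i < d) (w 0 i) ^+ 2 = 1].

Definition cone d (B : set 'rV[R]_d) : set 'rV[R]_d :=
  [set x | exists t w, 0 <= t <= 1 /\ B w /\ x = t *: w].

(** Normalized uniform (surface) measure on S^{d-1}, via the classical
    formula sigma(B) = d * Leb(cone B), normalized by sigma(S^{d-1}). *)
Definition unif_sphere d (B : set 'rV[R]_d) : \bar R :=
  (lebesgue_outer (cone (B `&` @unit_sphere d)) *
   ((fine (lebesgue_outer (cone (@unit_sphere d))))^-1)%:E)%E.

(** The parametrization  Omega |-> U^{-1}(m sqrt N, sqrt(N(rho-m^2)) Omega)
    of the microcanonical sphere; i0 is the first coordinate (value 0),
    the remaining coordinates of the rotated vector are given by Omega
    (indexed through unlift i0). *)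
Definition mc_param N (i0 : 'I_N) (U : 'M[R]_N) (m rho : R)
    (w : 'rV[R]_N.-1) : N.-tuple R :=
  let v : 'cV[R]_N := \col_i (match unlift i0 i with
                              | Some j => Num.sqrt (N%:R * (rho - m ^+ 2)) * w 0 j
                              | None => m * Num.sqrt N%:R end) in
  [tuple (invmx U *m v) i 0 | i < N].

Definition mu_MC N (i0 : 'I_N) (U : 'M[R]_N) (m rho : R)
    (A : set (N.-tuple R)) : \bar R :=
  unif_sphere [set w | A (mc_param i0 U m rho w)].

Definition coupling N (mu1 mu2 : set (N.-tuple R) -> \bar R)
    (g : probability (N.-tuple R * N.-tuple R)%type R) : Prop :=
  (forall A : set (N.-tuple R), measurable A -> g (A `*` setT) = mu1 A) /\
  (forall A : set (N.-tuple R), measurable A -> g (setT `*` A) = mu2 A).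

Definition sq_cost N (x y : N.-tuple R) : R :=
  N%:R^-1 * \sum_(i < N) (tnth x i - tnth y i) ^+ 2.

Definition w2 N (mu1 mu2 : set (N.-tuple R) -> \bar R) : \bar R :=
  sqrte (ereal_inf [set c | exists g, coupling mu1 mu2 g /\
           c = (\int[g]_z (sq_cost z.1 z.2)%:E)%E]).

End Defs.

(* Main.v *)
(** The two microcanonical spheres are images of the same uniform point Omega of
    the unit sphere, so the common Omega couples the two ensembles. Since U is
    orthogonal, the cost of this coupling is the constant
    (m - m')^2 + (sqrt (rho - m^2) - sqrt (rho - m'^2))^2, and the second
    difference is controlled by
    (s - s') (s + s') = (m' - m) (m' + m) with |m + m'| <= 2 sqrt rho.

    That the image of the surface measure is a probability measure rests on
    three facts. Half-spaces split boxes into boxes of complementary volume,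
    hence are Caratheodory measurable for the box outer measure; the cone over a
    subset of the sphere is, apart from its apex, a preimage under the measurable
    radial projection; and the unit ball has positive outer measure, because a
    countable cover of a cube by boxes has at least the volume of the cube, as
    integration along one coordinate at a time shows. *)
Require Import Defs.
From HB Require Import structures.
From mathcomp Require Import all_boot all_order all_algebra.
From mathcomp Require Import all_classical all_reals all_analysis.
From mathcomp Require Import measurable_realfun ring lra.
Import Order.TTheory GRing.Theory Num.Theory.
Local Open Scope ring_scope.

Section SphereMeasure.
Import numFieldNormedType.Exports.
Local Open Scope classical_set_scope.
Context {R : realType}.

(** * The box outer measure *)

Lemma box_vol_ge0 {d} (a b : 'rV[R]_d) : 0 <= box_vol a b.
Proof. by apply: prodr_ge0 => i _; rewrite le_max lexx orbT. Qed.

Lemma lebesgue_outer_ge0 {d} (A : set 'rV[R]_d) : (0 <= lebesgue_outer A)%E.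
Proof.
apply: le_ereal_inf_tmp => _ [a [b [_ ->]]].
by apply: nneseries_ge0 => k _ _; rewrite lee_fin box_vol_ge0.
Qed.

Lemma le_lebesgue_outer {d} (A B : set 'rV[R]_d) :
  A `<=` B -> (lebesgue_outer A <= lebesgue_outer B)%E.
Proof.
move=> AB; apply: ereal_inf_le_tmp => s [a [b [Bab ->]]].
by exists a, b; split => //; exact: subset_trans Bab.
Qed.

Lemma lebesgue_outer_le {d} {A : set 'rV[R]_d} (a b : nat -> 'rV[R]_d) :
  A `<=` \bigcup_k box (a k) (b k) ->
  (lebesgue_outer A <= \sum_(0 <= k <oo) (box_vol (a k) (b k))%:E)%E.
Proof. by move=> Aab; apply: ereal_inf_lbound; exists a, b. Qed.

(** All sides are zero. Positive dimension matters: the empty product is 1. *)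
Lemma box_vol0 {d} (a : 'rV[R]_d.+1) : box_vol a a = 0.
Proof.
by rewrite /box_vol big_ord_recl subrr maxxx mul0r.
Qed.

Lemma lebesgue_outer_box {d} (a b : 'rV[R]_d.+1) :
  (lebesgue_outer (box a b) <= (box_vol a b)%:E)%E.
Proof.
(* The single box is completed to a sequence by degenerate boxes at the origin. *)
apply: le_trans (lebesgue_outer_le (fun k => if k is 0%N then a else 0)
  (fun k => if k is 0%N then b else 0) _) _.
  by move=> x abx; exists 0%N.
rewrite nneseries_recl//; last by move=> k _; rewrite lee_fin box_vol_ge0.
rewrite eseries_cond eseries0 ?adde0// => -[|k]//= _ _.
by rewrite box_vol0.
Qed.

Lemma lebesgue_outer_set1 {d} (a : 'rV[R]_d.+1) : lebesgue_outer [set a] = 0%E.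
Proof.
apply/eqP; rewrite eq_le lebesgue_outer_ge0 andbT.
apply: le_trans (le_lebesgue_outer _ (box a a) _) _.
  by move=> _ -> i; rewrite lexx.
by rewrite (le_trans (lebesgue_outer_box _ _))// box_vol0.
Qed.

Lemma lebesgue_outer0 {d} : lebesgue_outer (set0 : set 'rV[R]_d.+1) = 0%E.
Proof.
apply/eqP; rewrite eq_le lebesgue_outer_ge0 andbT.
by rewrite (le_trans (le_lebesgue_outer set0 [set 0] _))// lebesgue_outer_set1.
Qed.

Lemma lebesgue_outer_adherent {d} (A : set 'rV[R]_d) (e : R) :
  0 < e -> (lebesgue_outer A != +oo)%E ->
  exists a b : nat -> 'rV[R]_d, A `<=` \bigcup_k box (a k) (b k) /\
   (\sum_(0 <= k <oo) (box_vol (a k) (b k))%:E <= lebesgue_outer A + e%:E)%E.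
Proof.
move=> e0 Aoo.
have Afin : lebesgue_outer A \is a fin_num.
  by rewrite ge0_fin_numE ?lebesgue_outer_ge0// ltey.
have [_ [a [b [Aab ->]]] /ltW] := lb_ereal_inf_adherent e0 Afin.
by exists a, b.
Qed.

Lemma lebesgue_outer_sigma_subadditive {d} :
  sigma_subadditive (@lebesgue_outer R d).
Proof.
move=> A; have [[i Aioo]|/forallNP Aoo] :=
  pselect (exists i, lebesgue_outer (A i) = +oo%E).
  rewrite (eseries_pinfty _ _ Aioo) ?leey// => n _.
  by rewrite -ltNye (lt_le_trans _ (lebesgue_outer_ge0 _)).
apply/lee_addgt0Pr => e e0.
apply: le_trans _
  (epsilon_trick xpredT (fun n => lebesgue_outer_ge0 (A n)) (ltW e0)).
have : forall n, exists ab : (nat -> 'rV[R]_d) * (nat -> 'rV[R]_d),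
    A n `<=` \bigcup_k box (ab.1 k) (ab.2 k) /\
    (\sum_(0 <= k <oo) (box_vol (ab.1 k) (ab.2 k))%:E <=
       lebesgue_outer (A n) + (e / (2 ^ n.+1)%:R)%:E)%E.
  move=> n; have en : 0 < e / (2 ^ n.+1)%:R by rewrite divr_gt0// ltr0n expn_gt0.
  by have [|a [b ab]] := lebesgue_outer_adherent (A n) _ en;
    [exact/eqP/Aoo | exists (a, b)].
move=> /choice[ab Aab].
pose v (n k : nat) : \bar R := (box_vol ((ab n).1 k) ((ab n).2 k))%:E.
have v0 n k : (0 <= v n k)%E by rewrite lee_fin box_vol_ge0.
(* An enumeration [f] of the pairs [(n, k)] merges the covers of all [A n] into one sequence of
   boxes. *)
have /card_esym/ppcard_eqP[f] := card_nat2.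
apply: (@le_trans _ _ (\sum_(0 <= n <oo) \sum_(0 <= k <oo) v n k)%E); last first.
  apply: lee_nneseries => [n _ _|n _]; [|exact: (Aab n).2].
  by apply: nneseries_ge0 => k _ _.
have -> : (\sum_(0 <= n <oo) \sum_(0 <= k <oo) v n k =
           \sum_(0 <= l <oo) v (f l).1 (f l).2)%E.
  rewrite [RHS]nneseries_esumT// nneseries_esumT; last first.
    by move=> n; apply: nneseries_ge0 => k _ _.
  under eq_esum do rewrite nneseries_esumT//.
  rewrite esum_esum// (_ : [set: nat] `*`` _ = [set: nat * nat]); last first.
    by apply/seteqP; split => // -[].
  by rewrite (reindex_esum [set: nat] [set: nat * nat] f).
apply: (lebesgue_outer_le (fun l => (ab (f l).1).1 (f l).2)
  (fun l => (ab (f l).1).2 (f l).2)) => x [n _ Anx].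
have [k _ xk] := (Aab n).1 _ Anx.
by exists (f^-1%FUN (n, k)) => //; rewrite invK ?inE.
Qed.

HB.instance Definition _ d := isOuterMeasure.Build R 'rV[R]_d.+1
  (@lebesgue_outer R d.+1) lebesgue_outer0 lebesgue_outer_ge0
  le_lebesgue_outer lebesgue_outer_sigma_subadditive.

(** * Caratheodory measurability of half-spaces and coordinates *)

Lemma halfspace_caratheodory {d} (i : 'I_d.+1) (c : R) :
  (@lebesgue_outer R d.+1).-caratheodory [set x | x 0 i < c].
Proof.
apply: (le_caratheodory_measurable (mu := @lebesgue_outer R d.+1)) => X.
apply: le_ereal_inf_tmp => _ [a [b [Xab ->]]].
(* Each box is cut at height [c] in direction [i]: [a'] raises its lower face to [c], [b'] lowers
   its upper face to [c]. *)
pose a' k : 'rV[R]_d.+1 :=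
  \row_j if j == i then Num.max (a k 0 j) c else a k 0 j.
pose b' k : 'rV[R]_d.+1 :=
  \row_j if j == i then Num.min (b k 0 j) c else b k 0 j.
have Hl : X `&` [set x | x 0 i < c] `<=` \bigcup_k box (a k) (b' k).
  move=> x [/Xab[k _ xk] /= xc]; exists k => // j; rewrite mxE.
  have /andP[-> xb] := xk j; case: eqP => [ji|//] /=.
  by rewrite le_min xb ji (ltW xc).
have Hr : X `&` ~` [set x | x 0 i < c] `<=` \bigcup_k box (a' k) (b k).
  move=> x [/Xab[k _ xk] /negP]; rewrite -leNgt => xc; exists k => // j.
  rewrite mxE; have /andP[xa ->] := xk j; rewrite andbT.
  by case: eqP => [ji|//]; rewrite ge_max xa ji.
apply: le_trans (leeD (lebesgue_outer_le _ _ Hl) (lebesgue_outer_le _ _ Hr)) _.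
rewrite -nneseriesD; try by move=> k _ _; rewrite lee_fin box_vol_ge0.
apply: lee_nneseries => [k _ _|k _].
  by rewrite -EFinD lee_fin addr_ge0 ?box_vol_ge0.
pose P := \prod_(j < d.+1 | j != i) Num.max (b k 0 j - a k 0 j) 0.
have volE (u v : 'rV[R]_d.+1) :
    (forall j, j != i -> v 0 j - u 0 j = b k 0 j - a k 0 j) ->
    box_vol u v = Num.max (v 0 i - u 0 i) 0 * P.
  move=> uv; rewrite /box_vol (bigD1 i)//=; congr *%R.
  by apply: eq_bigr => j /uv ->.
rewrite -EFinD lee_fin !volE//; try by move=> j /negPf ji; rewrite !mxE ji.
rewrite !mxE eqxx -mulrDl ler_wpM2r//.
  by apply: prodr_ge0 => j _; rewrite le_max lexx orbT.
(* The lengths of the two pieces of side [i] add up to the length of that side, also when a piece or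
   the box is empty. *)
by rewrite /Num.max /Num.min; do !case: ifP; lra.
Qed.

(** The open rays unbounded below generate the Borel sets, and their preimages are half-spaces. *)
Lemma measurable_coord {d} (i : 'I_d.+1) :
  measurable_fun setT
    (fun x : caratheodory_type (@lebesgue_outer R d.+1) => x 0 i).
Proof.
apply: (measurability _ (RGenInftyO.measurableE R)) => _ [_ [c ->] <-].
rewrite setTI; have := halfspace_caratheodory i c.
by congr caratheodory_measurable; apply/seteqP; split => x /=; rewrite in_itv.
Qed.

(** * Volume of a countable cover of a cube *)

Lemma integral_indic_itv (a b : R) :
  (\int[lebesgue_measure]_t (\1_(`[a, b]) t)%:E = (Num.max (b - a) 0)%:E)%E.
Proof.
rewrite integral_indic// setIT.
transitivity (lebesgue_measure `[a, b]%classic : \bar R) => //.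
rewrite lebesgue_measure_itv/= lte_fin.
by case: ltP => ab; [rewrite max_l ?subr_ge0 ?ltW | rewrite max_r ?subr_le0].
Qed.

(* Points are sequences [nat -> R] of which only the first [d] terms matter, and
   the boxes carry weights: slicing along the last coordinate absorbs the
   indicator of the last side of the box into the weight. *)
Lemma cube_le_weighted_cover {d} (r K : R) (c : nat -> R) (a b : nat -> nat -> R) :
  0 <= r -> 0 <= K -> (forall k, 0 <= c k) ->
  (forall x : nat -> R, (forall i, (0 <= x i <= r)%R) ->
    K%:E <= \sum_(0 <= k <oo)
      (c k * \prod_(i < d) \1_(`[a k i, b k i]) (x i))%:E)%E ->
  ((K * r ^+ d)%:E <= \sum_(0 <= k <oo)
      (c k * \prod_(i < d) Num.max (b k i - a k i) 0)%:E)%E.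
Proof.
move=> r0 K0; elim: d c => [|d IH] c c0 H.
  rewrite expr0 mulr1; have {H} := H (fun=> 0).
  under eq_eseriesr do rewrite big_ord0.
  under [in X in _ -> X]eq_eseriesr do rewrite big_ord0.
  by apply => i; rewrite lexx.
pose P k := \prod_(i < d) Num.max (b k i - a k i) 0.
have P0 k : 0 <= P k by apply: prodr_ge0 => i _; rewrite le_max lexx orbT.
have slice t : 0 <= t <= r -> ((K * r ^+ d)%:E <=
    \sum_(0 <= k <oo) ((c k * P k)%:E * (\1_(`[a k d, b k d]) t)%:E))%E.
  move=> t0r; have c'0 k : 0 <= c k * \1_(`[a k d, b k d]) t by rewrite mulr_ge0.
  have {}IH := IH _ c'0; apply: le_trans (IH _) _.
    move=> x x0r.
    (* Inserting [t] as coordinate [d] turns a point of the slice into a point of the full cube. *)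
    apply: le_trans (H (fun i => if i == d then t else x i) _) _.
      by move=> i; case: eqP.
    rewrite le_eqVlt; apply/orP; left; apply/eqP/eq_eseriesr => k _.
    congr EFin; rewrite big_ord_recr/= eqxx -[RHS]mulrA; congr (_ * _).
    rewrite mulrC; congr (_ * _).
    by apply: eq_bigr => i _; rewrite ltn_eqF.
  apply: lee_nneseries => [k _ _|k _].
    by rewrite lee_fin; exact: mulr_ge0 (c'0 k) (P0 k).
  by rewrite -EFinM lee_fin /P mulrAC.
have mitv k : measurable_fun [set: R]
    (fun t => (\1_(`[a k d, b k d]) t)%:E : \bar R).
  by apply/measurable_EFinP/measurable_indic.
have f0 k t : (0 <= (c k * P k)%:E * (\1_(`[a k d, b k d]) t)%:E :> \bar R)%E.
  by rewrite lee_fin mulr_ge0// mulr_ge0.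
have mf : measurable_fun [set: R] (fun t =>
    (\sum_(0 <= k <oo) ((c k * P k)%:E * (\1_(`[a k d, b k d]) t)%:E))%E).
  by apply: ge0_emeasurable_sum => // k _; apply: measurable_funeM.
(* Integrating the slice inequality over [[0, r]] gains the missing factor [r]; on the right,
   extending the integral to the whole line only increases it. *)
have : (\int[lebesgue_measure]_(t in `[0%R, r]) (K * r ^+ d)%:E <=
   \int[lebesgue_measure]_t
     \sum_(0 <= k <oo) ((c k * P k)%:E * (\1_(`[a k d, b k d]) t)%:E))%E.
  apply: (@le_trans _ _ (\int[lebesgue_measure]_(t in `[0%R, r])
     \sum_(0 <= k <oo) ((c k * P k)%:E * (\1_(`[a k d, b k d]) t)%:E))%E).
    apply: ge0_le_integral => //.
    - by move=> t _; rewrite lee_fin mulr_ge0// exprn_ge0.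
    - by apply: measurable_funS mf.
  apply: ge0_subset_integral => //.
  by move=> t _; apply: nneseries_ge0.
rewrite integral_cst// [X in (_ * X)%E](_ : _ = r%:E); last first.
  transitivity (lebesgue_measure `[0, r]%classic : \bar R) => //.
  rewrite lebesgue_measure_itv/= lte_fin sube0.
  by case: ltP => // r0'; congr EFin; apply/eqP; rewrite eq_le r0 r0'.
rewrite -EFinM -mulrA -exprSr => /le_trans; apply.
rewrite integral_nneseries//; last by move=> k; exact: measurable_funeM (mitv k).
rewrite le_eqVlt; apply/orP; left; apply/eqP/eq_eseriesr => k _.
have -> : (c k * \prod_(i < d.+1) Num.max (b k i - a k i) 0)%:E =
    ((c k * P k)%:E * (Num.max (b k d - a k d) 0)%:E)%E.
  by rewrite -EFinM big_ord_recr/= mulrA.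
rewrite -integral_indic_itv; apply: ge0_integralZl_EFin (mulr_ge0 _ _) => //.
exact: mitv.

Qed.

(** * The uniform measure on the sphere *)

Lemma cube_le_lebesgue_outer {d} (r : R) (A : set 'rV[R]_d.+1) : 0 <= r ->
  (forall x : 'rV_d.+1, (forall i, 0 <= x 0 i <= r) -> A x) ->
  ((r ^+ d.+1)%:E <= lebesgue_outer A)%E.
Proof.
move=> r0 cubeA; apply: le_ereal_inf_tmp => _ [a [b [Aab ->]]].
pose a' k i := a k 0 (inord i); pose b' k i := b k 0 (inord i).
have := @cube_le_weighted_cover d.+1 r 1 (fun=> 1) a' b' r0 ler01 (fun=> ler01).
rewrite mul1r => /(_ _)/le_trans; apply.
  move=> x x0r; have [k _ xk] := Aab _ (cubeA (\row_i x i) (fun i => eq_ind_r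
    (fun y => 0 <= y <= r) (x0r i) (mxE _ _ _ _))).
  have u0 j :
      (0 <= (1 * \prod_(i < d.+1) \1_(`[a' j i, b' j i]) (x i))%:E :> \bar R)%E.
    by rewrite lee_fin mul1r prodr_ge0.
  (* The box [k] containing the point already contributes 1; the other terms are nonnegative. *)
  rewrite (@nneseriesD1 _ _ k xpredT)//.
  rewrite mul1r big1 ?leeDl ?nneseries_ge0// => i _.
  rewrite indicE mem_set//= in_itv/= /a' /b' inord_val.
  by have := xk i; rewrite mxE.
apply: lee_nneseries => [k _ _|k _].
  by rewrite lee_fin mul1r prodr_ge0// => i _; rewrite le_max lexx orbT.
rewrite lee_fin mul1r le_eqVlt; apply/orP; left; apply/eqP.
by apply: eq_bigr => i _; rewrite /a' /b' inord_val.
Qed.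

(** * Cones and the radial projection *)

Definition sqnorm {d} (x : 'rV[R]_d) : R := \sum_i x 0 i ^+ 2.

(** The radial projection onto the unit sphere; the convention that [0^-1] is [0] makes it fix the
    origin. *)
Definition normalize {d} (x : 'rV[R]_d) : 'rV[R]_d := (Num.sqrt (sqnorm x))^-1 *: x.

Lemma sqnorm_ge0 {d} (x : 'rV[R]_d) : 0 <= sqnorm x.
Proof. by apply: sumr_ge0 => i _; exact: sqr_ge0. Qed.

Lemma sqnormZ {d} t (x : 'rV[R]_d) : sqnorm (t *: x) = t ^+ 2 * sqnorm x.
Proof. by rewrite /sqnorm mulr_sumr; apply: eq_bigr => i _; rewrite mxE exprMn. Qed.

Lemma sqnorm_eq0 {d} (x : 'rV[R]_d) : (sqnorm x == 0) = (x == 0).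
Proof.
apply/eqP/eqP => [|->]; last first.
  by rewrite /sqnorm big1// => i _; rewrite mxE expr0n.
move=> /eqP; rewrite psumr_eq0 => [/allP x0|i _]; last exact: sqr_ge0.
apply/rowP => i; rewrite mxE; apply/eqP.
by have := x0 i (mem_index_enum _); rewrite sqrf_eq0.
Qed.

Lemma sqnorm_normalize {d} (x : 'rV[R]_d) :
  0 < sqnorm x -> sqnorm (normalize x) = 1.
Proof. by move=> x0; rewrite sqnormZ exprVn sqr_sqrtr ?ltW// mulVf ?gt_eqF. Qed.

(* The cone over [B] is, up to its apex, the preimage of [B] under the radial
   projection: this makes its measurability a consequence of that of [B]. *)
Lemma cone_minus_apex {d} (B : set 'rV[R]_d) :
  cone (B `&` @unit_sphere R d) `\ 0 =
  normalize @^-1` B `&` [set x | 0 < sqnorm x <= 1].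
Proof.
apply/seteqP; split => x /=.
  move=> [[t [w [/andP[t0 t1] [[Bw w1] ->]]]] /eqP tw0].
  have {}w1 : sqnorm w = 1 by [].
  have tgt0 : 0 < t.
    by rewrite lt_def t0 andbT; apply: contraNneq tw0 => ->; rewrite scale0r.
  rewrite sqnormZ w1 mulr1 exprn_gt0// exprn_ile1//; split => //.
  rewrite /normalize sqnormZ w1 mulr1 sqrtr_sqr ger0_norm// scalerA.
  by rewrite mulVf ?gt_eqF// scale1r.
move=> [Bx /andP[x0 x1]]; split; last first.
  by apply/eqP; rewrite -sqnorm_eq0 gt_eqF.
exists (Num.sqrt (sqnorm x)), (normalize x); split.
  by rewrite sqrtr_ge0 -sqrtr1 ler_wsqrtr.
split; first by split => //; exact: sqnorm_normalize.
by rewrite scalerA divff ?scale1r// gt_eqF// sqrtr_gt0.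
Qed.

Lemma lebesgue_outer_setD1 {d} (A : set 'rV[R]_d.+1) (x : 'rV[R]_d.+1) :
  lebesgue_outer (A `\ x) = lebesgue_outer A.
Proof.
apply/eqP; rewrite eq_le le_lebesgue_outer/=; last by apply: subDsetl.
apply: le_trans (le_lebesgue_outer A (A `\ x `|` [set x]) _) _.
  by move=> y Ay; have [->|yx] := pselect (y = x); [right|left].
apply: le_trans (outer_measureU2 _ _ _) _.
by rewrite [X in (_ + X)%E]lebesgue_outer_set1 adde0.
Qed.

Lemma lebesgue_outer_ball_gt0 {d} :
  (0 < lebesgue_outer (cone (@unit_sphere R d.+1)))%E.
Proof.
rewrite -(setTI (@unit_sphere _ _)) -(lebesgue_outer_setD1 _ 0) cone_minus_apex.
rewrite preimage_setT setTI.
(* With this side the cube fits in the unit ball: [r <= 1] bounds each squared coordinate by [r],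
   and the [d.+1] bounds sum to 1. *)
pose r : R := d.+1%:R^-1.
have r0 : 0 < r by rewrite invr_gt0.
have : ((r ^+ d.+1)%:E <=
    lebesgue_outer [set x : 'rV[R]_d.+1 | (sqnorm x <= 1)%R])%E.
  apply: cube_le_lebesgue_outer; first exact: ltW.
  move=> x x0r /=; apply: (@le_trans _ _ (\sum_(i < d.+1) r)).
    apply: ler_sum => i _; have /andP[xi0 xir] := x0r i.
    rewrite (le_trans _ xir)// expr2 ler_piMl// (le_trans xir)//.
    by rewrite invf_le1 ?ler1n.
  by rewrite sumr_const card_ord -[X in X <= _]mulr_natr mulVf// pnatr_eq0.
rewrite -(lebesgue_outer_setD1 _ 0) => rA.
apply: lt_le_trans (le_trans rA _); first by rewrite lte_fin exprn_gt0.
apply: le_lebesgue_outer => x [x1 /eqP x0] /=.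
by rewrite x1 andbT lt_def sqnorm_ge0 sqnorm_eq0 x0.
Qed.

Lemma lebesgue_outer_ball_lty {d} :
  (lebesgue_outer (cone (@unit_sphere R d.+1)) < +oo)%E.
Proof.
apply: le_lt_trans (le_lebesgue_outer _ (box (const_mx (-1)) (const_mx 1)) _) _.
  move=> _ [t [w [/andP[t0 t1] [w1 ->]]]] i; rewrite !mxE -ler_norml normrM.
  rewrite ger0_norm// mulr_ile1// -(@expr_le1 _ 2)// -normrX ger0_norm ?sqr_ge0//.
  by rewrite -w1 (bigD1 i)//= lerDl sumr_ge0// => j _; exact: sqr_ge0.
exact: le_lt_trans (lebesgue_outer_box _ _) (ltry _).
Qed.

Lemma measurable_sqnorm {d} : measurable_fun setT
  (sqnorm : caratheodory_type (@lebesgue_outer R d.+1) -> R).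
Proof.
apply: measurable_sum => i; apply: measurable_funX; exact: measurable_coord.
Qed.

Lemma measurable_normalize_coord {d} (i : 'I_d.+1) : measurable_fun setT
  (fun x : caratheodory_type (@lebesgue_outer R d.+1) => normalize x 0 i).
Proof.
(* The inverse norm is written as a measurable power of [sqnorm]; at the origin both sides are 0. *)
rewrite (_ : (fun _ => _) = fun x => powR (sqnorm x) (- 2^-1) * x 0 i).
  apply: measurable_funM; last exact: measurable_coord.
  exact: (measurableT_comp (measurable_powR _) measurable_sqnorm).
by apply/funext => x; rewrite mxE powRN powR12_sqrt// sqnorm_ge0.
Qed.

(** The witness is the law of [f \o normalize] under normalized volume on the punctured unit ball,
    since the preimage of [B] there is the punctured cone over [B]. *)
Lemma unif_sphere_distribution {d d'} {Y : measurableType d'}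
    (f : 'rV[R]_d.+1 -> Y) :
  measurable_fun setT
    (f \o normalize : caratheodory_type (@lebesgue_outer R d.+1) -> Y) ->
  exists P : probability Y R,
    forall A, measurable A -> P A = unif_sphere (f @^-1` A).
Proof.
move=> mf.
pose om : {outer_measure set 'rV[R]_d.+1 -> \bar R} := @lebesgue_outer R d.+1.
pose mu : {measure set (caratheodory_type om) -> \bar R} :=
  om : set (caratheodory_type om) -> \bar R.
pose D : set (caratheodory_type (@lebesgue_outer R d.+1)) :=
  [set x | 0 < sqnorm x <= 1].
have mD : measurable D.
  rewrite (_ : D = sqnorm @^-1` `]0, 1]).
    by rewrite -[X in measurable X]setTI; exact: measurable_sqnorm.
  by apply/seteqP; split => x; rewrite /D /= in_itv.
pose nu : {measure set (caratheodory_type om) -> \bar R} := mrestr mu mD.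
pose f' : {mfun caratheodory_type om >-> Y} := mfun_Sub (mem_set mf).
(* [dirac point] is the default for total mass 0 or infinity, both excluded by the bounds on the
   ball. *)
exists (distribution (mnormalize nu (dirac point)) f') => A mA.
have nuE B : nu (normalize @^-1` B) =
    lebesgue_outer (cone (B `&` @unit_sphere R d.+1)).
  by rewrite -(lebesgue_outer_setD1 _ 0) cone_minus_apex.
have nuT : nu setT = lebesgue_outer (cone (@unit_sphere R d.+1)).
  by rewrite -(preimage_setT normalize) nuE setTI.
rewrite /= /distribution /pushforward /= /mnormalize nuT.
rewrite gt_eqF ?lebesgue_outer_ball_gt0//.
by rewrite lt_eqF ?lebesgue_outer_ball_lty//= comp_preimage nuE.
Qed.

(** * The coupling *)

Lemma measurable_mc_param_normalize {n} (i0 : 'I_n.+2) (U : 'M[R]_n.+2)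
    (m rho : R) :
  measurable_fun setT (mc_param i0 U m rho \o normalize :
    caratheodory_type (@lebesgue_outer R n.+1) -> n.+2.-tuple R).
Proof.
apply/measurable_fun_tnthP => i.
rewrite (_ : _ \o _ = fun x : 'rV[R]_n.+1 => \sum_j invmx U i j *
    (if unlift i0 j is Some k
     then Num.sqrt (n.+2%:R * (rho - m ^+ 2)) * normalize x 0 k
     else m * Num.sqrt n.+2%:R)); last first.
  apply/funext => x /=; rewrite tnth_mktuple mxE.
  by apply: eq_bigr => j _; rewrite mxE.
apply: measurable_sum => j; apply: measurable_funM => //.
case: unlift => [k|//]; apply: measurable_funM => //.
exact: measurable_normalize_coord.
Qed.

Lemma sum_sqr_orthogonal {n} (U : 'M[R]_n) (v : 'cV[R]_n) : U *m U^T = 1%:M ->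
  \sum_i (invmx U *m v) i 0 ^+ 2 = \sum_i v i 0 ^+ 2.
Proof.
move=> UUT; have [unitU _] := mulmx1_unit UUT.
have -> : invmx U = U^T by rewrite -[RHS](mulKmx unitU) UUT mulmx1.
have sumE (w : 'cV[R]_n) : \sum_i w i 0 ^+ 2 = (w^T *m w) 0 0.
  by rewrite mxE; apply: eq_bigr => i _; rewrite mxE expr2.
by rewrite !sumE trmx_mul trmxK mulmxA -[in LHS](mulmxA v^T) UUT mulmx1.
Qed.

(** The rotation preserves norms, so the cost is computed before it: the first coordinate yields the
    term in [m - m'], the others sum through [sqnorm w = 1]. *)
Lemma sq_cost_mc_param {n} (i0 : 'I_n.+2) (U : 'M[R]_n.+2) (m m' rho : R) w :
  i0 = ord0 -> U *m U^T = 1%:M -> sqnorm w = 1 ->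
  sq_cost (mc_param i0 U m rho w) (mc_param i0 U m' rho w) =
  (m - m') ^+ 2 + (Num.sqrt (rho - m ^+ 2) - Num.sqrt (rho - m' ^+ 2)) ^+ 2.
Proof.
move=> -> UUT w1.
pose v q : 'cV[R]_n.+2 := \col_i (if unlift ord0 i is Some j
  then Num.sqrt (n.+2%:R * (rho - q ^+ 2)) * w 0 j else q * Num.sqrt n.+2%:R).
have -> : sq_cost (mc_param ord0 U m rho w) (mc_param ord0 U m' rho w) =
    n.+2%:R^-1 * \sum_i (invmx U *m (v m - v m')) i 0 ^+ 2.
  congr (_ * _); apply: eq_bigr => i _.
  rewrite !tnth_mktuple mulmxBr; congr (_ ^+ 2).
  by rewrite [RHS]mxE [X in _ = _ + X]mxE.
rewrite (sum_sqr_orthogonal _ _ UUT) big_ord_recl !mxE unlift_none.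
have N0 : 0 <= n.+2%:R :> R by [].
set s := Num.sqrt (rho - m ^+ 2); set s' := Num.sqrt (rho - m' ^+ 2).
rewrite (eq_bigr (fun j => n.+2%:R * (s - s') ^+ 2 * w 0 j ^+ 2)); last first.
  move=> j _; rewrite !mxE liftK !sqrtrM// -/s -/s' -[in RHS](sqr_sqrtr N0); ring.
rewrite -mulr_sumr -/(sqnorm w) w1 mulr1.
have -> : (m * Num.sqrt n.+2%:R - m' * Num.sqrt n.+2%:R) ^+ 2 =
   n.+2%:R * (m - m') ^+ 2 by rewrite -[in RHS](sqr_sqrtr N0); ring.
by rewrite -mulrDr mulKf// pnatr_eq0.
Qed.

Lemma unif_sphere_full {d} (A : set 'rV[R]_d) :
  @unit_sphere R d `<=` A -> unif_sphere A = unif_sphere [set: 'rV[R]_d].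
Proof. by move=> SA; rewrite /unif_sphere setTI setIidr. Qed.

(** The sublevel set has full mass, so its complement is null and the bound holds almost
    everywhere. *)
Lemma expectation_le_cst {d} {T : measurableType d} (P : probability T R)
    (f : T -> R) (c : R) : 0 <= c -> (forall x, 0 <= f x) ->
  measurable_fun setT f -> P (f @^-1` `]-oo, c]) = 1%E ->
  (\int[P]_x (f x)%:E <= c%:E)%E.
Proof.
move=> c0 f0 mf Pc.
have mA : measurable (f @^-1` `]-oo, c]).
  by rewrite -[X in measurable X]setTI; exact: mf.
apply: (@le_trans _ _ (\int[P]_x (cst c%:E x))%E); last first.
  by rewrite integral_cst// [X in (_ * X)%E]probability_setT mule1.
apply: ae_ge0_le_integral => //.
- by move=> x _; rewrite lee_fin.
- exact/measurable_EFinP.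
exists (~` (f @^-1` `]-oo, c])); split => //.
- exact: measurableC.
- transitivity (1 - P (f @^-1` `]-oo, c]))%E; first exact: probability_setC.
  by rewrite Pc subee.
- by move=> x /=; apply: contra_not; rewrite in_itv/= => fxc _; rewrite lee_fin.
Qed.

Lemma measurable_sq_cost {n} : measurable_fun setT
  (fun z : n.-tuple R * n.-tuple R => sq_cost z.1 z.2).
Proof.
apply: measurable_funM => //; apply: measurable_sum => i.
apply: measurable_funX; apply: measurable_funB.
  exact: (measurableT_comp (measurable_tnth i) measurable_fst).
exact: (measurableT_comp (measurable_tnth i) measurable_snd).
Qed.

(** * Lipschitz estimate for the radii *)

Lemma sqrt_sub_sqr_lipschitz (rho m m' : R) : 0 < rho ->
  - Num.sqrt rho < m < Num.sqrt rho -> - Num.sqrt rho < m' < Num.sqrt rho ->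
  `|Num.sqrt (rho - m ^+ 2) - Num.sqrt (rho - m' ^+ 2)| <=
  2 / Num.sqrt (1 - m ^+ 2 / rho) * `|m - m'|.
Proof.
move=> rho0 mrho m'rho.
set r := Num.sqrt rho in mrho m'rho *.
have r0 : 0 < r by rewrite sqrtr_gt0.
have r2 : r ^+ 2 = rho by rewrite sqr_sqrtr// ltW.
have a0 : 0 < rho - m ^+ 2 by rewrite -r2; nra.
have a'0 : 0 < rho - m' ^+ 2 by rewrite -r2; nra.
set s := Num.sqrt (rho - m ^+ 2); set s' := Num.sqrt (rho - m' ^+ 2).
have s0 : 0 < s by rewrite sqrtr_gt0.
have s'0 : 0 < s' by rewrite sqrtr_gt0.
have s2 : s ^+ 2 = rho - m ^+ 2 by rewrite sqr_sqrtr// ltW.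
have s'2 : s' ^+ 2 = rho - m' ^+ 2 by rewrite sqr_sqrtr// ltW.
have -> : Num.sqrt (1 - m ^+ 2 / rho) = s / r.
  have -> : 1 - m ^+ 2 / rho = (rho - m ^+ 2) / rho by field; rewrite gt_eqF.
  by rewrite sqrtrM ?ltW// sqrtrV ?ltW.
have -> : 2 / (s / r) * `|m - m'| = (2 * r * `|m - m'|) / s.
  by field; rewrite !gt_eqF.
rewrite ler_pdivlMr//.
have : `|s - s'| * (s + s') = `|m - m'| * `|m + m'|.
  rewrite -[X in _ * X]gtr0_norm ?addr_gt0// -!normrM -subr_sqr s2 s'2.
  by rewrite -subr_sqr -normrN; congr `|_|; ring.
have mm' : `|m + m'| <= 2 * r by rewrite ler_norml; apply/andP; split; lra.
have := ler_wpM2l (normr_ge0 (m - m')) mm'.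
(* Dropping the [s'] part of [s + s'] leaves a constant that depends on [m] but not on [m']. *)
have := mulr_ge0 (normr_ge0 (s - s')) (ltW s'0).
lra.
Qed.

End SphereMeasure.

Theorem theorem4p7 (R : realType) (rho m m' : R) (N : nat)
    (i0 : 'I_N) (U : 'M[R]_N) :
  0 < rho ->
  - Num.sqrt rho < m < Num.sqrt rho ->
  - Num.sqrt rho < m' < Num.sqrt rho ->
  (2 <= N)%N ->
  nat_of_ord i0 = 0%N ->
  U *m U^T = 1%:M ->
  (forall j : 'I_N, U i0 j = (Num.sqrt N%:R)^-1) ->
  (w2 (mu_MC i0 U m rho) (mu_MC i0 U m' rho)
     <= ((1 + 2 / Num.sqrt (1 - m ^+ 2 / rho)) * `|m - m'|)%:E)%E.
Proof.
case: N i0 U => [|[|n]] i0 U// rho0 mrho m'rho _ i00 UUT _.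
have {}i00 : i0 = ord0 by exact/val_inj.
(* Both parametrizations are taken at the same [w]; the law of [p] is the coupling. *)
pose p w := (mc_param i0 U m rho w, mc_param i0 U m' rho w).
have [g gE] := unif_sphere_distribution p
  (measurable_fun_pair (measurable_mc_param_normalize i0 U m rho)
                       (measurable_mc_param_normalize i0 U m' rho)).
pose a := `|m - m'|.
pose b := `|Num.sqrt (rho - m ^+ 2) - Num.sqrt (rho - m' ^+ 2)|.
have cost_le : (\int[g]_z (sq_cost z.1 z.2)%:E <= (a ^+ 2 + b ^+ 2)%:E)%E.
  apply: expectation_le_cst.
  - by rewrite addr_ge0 ?sqr_ge0.
  - by move=> z; rewrite mulr_ge0// sumr_ge0// => i _; exact: sqr_ge0.
  - exact: measurable_sq_cost.
  rewrite gE; last by rewrite -[X in measurable X]setTI; exact: measurable_sq_cost.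
  (* [unif_sphere] only sees the unit sphere, where the cost equals the bound. *)
  rewrite unif_sphere_full; last first.
    move=> w w1; rewrite /= in_itv/= sq_cost_mc_param//.
    by rewrite !real_normK ?num_real.
  by rewrite -(preimage_setT p) -gE ?probability_setT.
have w2_le : (w2 (mu_MC i0 U m rho) (mu_MC i0 U m' rho) <=
    sqrte (a ^+ 2 + b ^+ 2)%:E)%E.
  rewrite /w2 lee_sqrt; last by rewrite lee_fin addr_ge0 ?sqr_ge0.
  apply: ge_ereal_inf; exists (\int[g]_z (sq_cost z.1 z.2)%:E)%E => //.
  exists g; split => //; split => A mA.
    rewrite gE; last exact: measurableX.
    by congr unif_sphere; apply/seteqP; split => w /=; [case|].
  rewrite gE; last exact: measurableX.
  by congr unif_sphere; apply/seteqP; split => w /=; [case|].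
apply: le_trans w2_le _; rewrite lee_fin.
apply: (@le_trans _ _ (a + b)).
  have a0 : 0 <= a by exact: normr_ge0.
  have b0 : 0 <= b by exact: normr_ge0.
  (* [a + b] is the root of its square, which exceeds [a ^+ 2 + b ^+ 2] by [2 * (a * b)]. *)
  rewrite -(ger0_norm (addr_ge0 a0 b0)) -sqrtr_sqr ler_wsqrtr//.
  by have := mulr_ge0 a0 b0; lra.
by rewrite mulrDl mul1r lerD2l sqrt_sub_sqr_lipschitz.
Qed.
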